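(* Let $H/K$ be an irreducible compact symmetric space with $H$ and $K$ simple, and let $D(u)$ be the detector of the three-factor branch $(x,x,z,u,1)$ on $H^3/\Delta K$ (a polynomial in $u$ defined up to a nonzero constant). Then $D$ can be normalized so that $$D(0)>0,\qquad D(1/6)>0,\qquad \lim_{u\to+\infty}D(u)=+\infty,$$ and $$\operatorname{sgn}D(1)=\operatorname{sgn}\Xi(\rho,\sigma).$$ Consequently, if $\Xi(\rho,\sigma)<0$, then $D$ has a root in $(1/6,1)$ and a root in $(1,\infty)$.
   Context: Let $\mathfrak h=\mathfrak k\oplus\mathfrak q$ be the symmetric decomposition, $d=\dim\mathfrak q$, $e=\dim\mathfrak k$, and let $a\in(0,1)$ be the embedding constant defined by $B_{\mathfrak k}=a\,B_{\mathfrak h}|_{\mathfrak k}$ (Killing forms); it satisfies $e(1-a)=d/2$. Put $\rho=e/d$, $\sigma=a(1-a)$, and $$\Xi(\rho,\sigma)=\rho^2(320\rho^2+880\rho+605)\sigma^2-18(8\rho^3+16\rho^2-27\rho-24)\sigma-243.$$ Metrics: with $Q=-B_{\mathfrak h}$ on each factor, the tangent space of $H^3/\Delta K$ is $\mathfrak q_1\oplus\mathfrak q_2\oplus\mathfrak q_3\oplus(v_1\otimes\mathfrak k)\oplus(v_2\otimes\mathfrak k)$, $v_1=\frac1{\sqrt2}(1,-1,0)$, $v_2=\frac1{\sqrt6}(1,1,-2)$, and $(x,x,z,u,1)$ is the invariant metric with these $Q$-multiples on the mutually orthogonal summands. Its Ricci eigenvalues are $$r_1=r_2=\frac{-3u+12x-1}{24x^2},\quad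 r_3=\frac{3z-1}{6z^2},\quad r_4=\frac{du}{8ex^2}+\frac a{2u}-\frac a{12u^2},\quad r_5=\frac{3a}8+\frac d{12ez^2}+\frac d{24ex^2}+\frac a{24u^2}.$$ Definition of the detector: let $E_1,E_2,E_3$ be the polynomials obtained from $r_3=r_1$, $r_4=r_1$, $r_5=r_1$ by clearing denominators, i.e. (up to constants) $E_1=(3u+1-12x)z^2+12x^2z-4x^2$, $E_2=2a(6u-1)x^2-12u^2x+u^2(3u/\rho+3u+1)$, $E_3=9au^2x^2z^2+2u^2x^2/\rho+u^2z^2/\rho+ax^2z^2-u^2z^2(12x-3u-1)$. Let $R(x,u)=x^{-4}\operatorname{Res}_z(E_1,E_3)$, a polynomial. Then $\operatorname{Res}_x(E_2,R)=C\,u^8(u-1)^2D(u)$ with a nonzero constant $C$ depending only on $(d,e,a)$; the polynomial $D$ is the detector, and ''normalized'' means choosing its nonzero constant factor. *)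

(* Defs.v *)
From HB Require Import structures.
From mathcomp Require Import all_boot all_order all_algebra.
From mathcomp Require Import all_classical all_reals all_analysis.
From mathcomp Require Import ring.

Set Implicit Arguments.
Unset Strict Implicit.
Unset Printing Implicit Defensive.

Import Order.TTheory GRing.Theory Num.Theory.
Import numFieldNormedType.Exports.

Local Open Scope ring_scope.

(** Compact symmetric pairs, at the level of Lie algebras: a symmetric space
    H/K enters through the Lie algebra h of H and the differential theta of the
    involution, k being the Lie algebra of K. *)

Section LieAlgebra.
Variables (R : realType) (h : vectType R) (br : h -> h -> h).

Record lie_bracket : Prop := LieBracket {
  lie_linearl : forall y, linear (br^~ y);
  lie_linearr : forall x, linear (br x);
  lie_alternating : forall x, br x x = 0;
  lie_jacobi : forall x y z,
    br x (br y z) + br y (br z x) + br z (br x y) = 0 }.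

Definition lie_subalgebra (g : {vspace h}) : Prop :=
  {in g &, forall x y, br x y \in g}.

Definition lie_stable (g V : {vspace h}) : Prop :=
  forall x v, x \in g -> v \in V -> br x v \in V.

Record lie_simple (g : {vspace h}) : Prop := LieSimple {
  simple_subalgebra : lie_subalgebra g;
  simple_nonabelian : exists x y, [/\ x \in g, y \in g & br x y != 0];
  simple_ideals : forall I : {vspace h},
    (I <= g)%VS -> lie_stable g I -> I = 0%VS \/ I = g }.

(** Trace of the restriction of f to g, meaningful when f maps g to g. *)
Definition trace_on (g : {vspace h}) (f : h -> h) : R :=
  \sum_(i < \dim g) coord (vbasis g) i (f (vbasis g)`_i).

(** Killing form of the subalgebra g (not the restriction to g of the Killing
    form of h); that of h is [killing fullv]. *)
Definition killing (g : {vspace h}) (x y : h) : R :=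
  trace_on g (fun v => br x (br y v)).

Definition lie_compact : Prop := forall x, x != 0 -> killing fullv x x < 0.

Variable theta : 'End(h).

Definition sym_k : {vspace h} := fixedSpace theta.
Definition sym_q : {vspace h} := passmx.leigenspace theta (- 1).

Record irreducible_compact_symmetric : Prop := IrreducibleCompactSymmetric {
  sym_lie : lie_bracket;
  sym_compact : lie_compact;
  sym_involution : forall x, theta (theta x) = x;
  sym_automorphism : forall x y, theta (br x y) = br (theta x) (theta y);
  sym_nontrivial : sym_q != 0%VS;
  sym_irreducible : forall V : {vspace h},
    (V <= sym_q)%VS -> lie_stable sym_k V -> V = 0%VS \/ V = sym_q }.

Definition embedding_constant (a : R) : Prop :=
  {in sym_k &, forall x y, killing sym_k x y = a * killing fullv x y}.

End LieAlgebra.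

(** Ricci eigenvalues of the metric (x,x,z,u,1) on H^3/Delta K, with
    d = dim q and e = dim k. *)

Section Ricci.
Variable F : realFieldType.
Implicit Types d e a x z u : F.

Definition ricci1 x u := (- 3 * u + 12 * x - 1) / (24 * x ^+ 2).
Definition ricci3 z := (3 * z - 1) / (6 * z ^+ 2).
Definition ricci4 d e a x u :=
  d * u / (8 * e * x ^+ 2) + a / (2 * u) - a / (12 * u ^+ 2).
Definition ricci5 d e a x z u :=
  3 * a / 8 + d / (12 * e * z ^+ 2) + d / (24 * e * x ^+ 2)
  + a / (24 * u ^+ 2).

End Ricci.

(** The cleared equations; s stands for 1 / rho = d / e. They are written over
    an arbitrary commutative ring so that the arguments can be both scalars and
    polynomial indeterminates. *)

Section Einstein.
Variable A : comNzRingType.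
Implicit Types a s x z u : A.

Definition einstein1 x z u :=
  (3 * u + 1 - 12 * x) * z ^+ 2 + 12 * x ^+ 2 * z - 4 * x ^+ 2.
Definition einstein2 a s x u :=
  2 * a * (6 * u - 1) * x ^+ 2 - 12 * u ^+ 2 * x
  + u ^+ 2 * (3 * u * s + 3 * u + 1).
Definition einstein3 a s x z u :=
  9 * a * u ^+ 2 * x ^+ 2 * z ^+ 2 + 2 * u ^+ 2 * x ^+ 2 * s
  + u ^+ 2 * z ^+ 2 * s + a * x ^+ 2 * z ^+ 2
  - u ^+ 2 * z ^+ 2 * (12 * x - 3 * u - 1).

End Einstein.

Lemma einstein1E (F : realFieldType) (x z u : F) : x != 0 -> z != 0 ->
  einstein1 x z u = 24 * x ^+ 2 * z ^+ 2 * (ricci3 z - ricci1 x u).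
Proof. by move=> x0 z0; rewrite /einstein1 /ricci3 /ricci1; field; rewrite x0. Qed.

Lemma einstein2E (F : realFieldType) (d e a x u : F) :
  e != 0 -> x != 0 -> u != 0 ->
  einstein2 a (d / e) x u =
    24 * x ^+ 2 * u ^+ 2 * (ricci4 d e a x u - ricci1 x u).
Proof.
by move=> e0 x0 u0; rewrite /einstein2 /ricci4 /ricci1; field; rewrite e0 x0 u0.
Qed.

Lemma einstein3E (F : realFieldType) (d e a x z u : F) :
  e != 0 -> x != 0 -> z != 0 -> u != 0 ->
  einstein3 a (d / e) x z u =
    24 * x ^+ 2 * z ^+ 2 * u ^+ 2 * (ricci5 d e a x z u - ricci1 x u).
Proof.
move=> e0 x0 z0 u0; rewrite /einstein3 /ricci5 /ricci1.
by field; rewrite e0 x0 z0 u0.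
Qed.

Section Detector.
Variable R : realType.
Implicit Types (a rho sigma : R) (D : {poly R}).

(** Indeterminates, outermost first: (z, x, u) for E1 and E3, (x, u) for E2. *)
Definition E1 : {poly {poly {poly R}}} := einstein1 'X%:P 'X 'X%:P%:P.
Definition E2 a rho : {poly {poly R}} :=
  einstein2 a%:P%:P (rho^-1)%:P%:P 'X 'X%:P.
Definition E3 a rho : {poly {poly {poly R}}} :=
  einstein3 a%:P%:P%:P (rho^-1)%:P%:P%:P 'X%:P 'X 'X%:P%:P.

(** Determines D up to a nonzero constant factor. *)
Definition is_detector a rho D : Prop :=
  exists (Rxu : {poly {poly R}}) (C : R),
    [/\ resultant E1 (E3 a rho) = 'X^4 * Rxu,
        C != 0
      & resultant (E2 a rho) Rxu = C *: ('X^8 * ('X - 1) ^+ 2 * D)].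

Definition Xi rho sigma : R :=
  rho ^+ 2 * (320 * rho ^+ 2 + 880 * rho + 605) * sigma ^+ 2
  - 18 * (8 * rho ^+ 3 + 16 * rho ^+ 2 - 27 * rho - 24) * sigma - 243.

End Detector.

(* Main.v *)
Require Import Defs.
From HB Require Import structures.
From mathcomp Require Import all_boot all_order all_algebra.
From mathcomp Require Import all_classical all_reals all_analysis.
From mathcomp Require Import polyrcf.
From mathcomp Require Import ring lra zify.

(** The Lie-theoretic hypotheses enter only through the bounds 0 < a < 1 and
    the identity 2 (1 - a) dim k = dim q for the embedding constant a; the
    identity says that s := 1 / rho = d / e is 2 (1 - a), so that everything below
    depends on the single number a.  They come from the positive definite form
    Q = - B_h: for a Q-orthonormal basis (x_i) of k and (y_j) of q,
    invariance turns every trace of ad x ad y into a sum of squared norms of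
    brackets, and the two counts
      (1 - a) dim k = sum_(i, j) |[x_i, y_j]|^2   and
      dim q = 2 sum_(i, j) |[x_i, y_j]|^2
    give the dimension identity ([embedding_dim]).  Positivity of a follows
    because k is not abelian, and a < 1 because q is not 0.

    The detector is computed in closed form.  E3 = A z^2 + 2 s u^2 x^2 has no
    linear term in z, and
      Res_z(E1, E3) = x^4 (G^2 + 288 s u^2 x^2 A),
      G = 2 s u^2 (3 u + 1 - 12 x) + 4 A.
    Modulo E2 the terms of odd degree in x can be traded for even ones:
      A = (3 u - 1) (3 a (u - 1) x^2 - s u^2),
      G = 4 a H x^2 - 2 s u^2 K,
    with H and K as in [dtrH] and [dtrK].  So the quartic R is congruent to
    r(x^2) with r quadratic, and Res_x(E2, R) is a resultant of two quadratics
    in the variable x^2, namely a square minus a product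
    ([resultant_even_remainder]).  Each of the three factors is
    divisible by u - 1 and by a power of u, and what is left is
      D = a X^2 + 4 s Y Z
    up to a constant ([resultant_E2_elim_z]).

    The signs are read off this formula.  D(0) is a product of powers.  At
    u = 1/6 the leading coefficient of E2 vanishes, most terms disappear and
    the rest is a sum of products of positive numbers.  At u = 1 one finds Xi
    times a positive factor.  At infinity X has degree 5 and Y Z degree at most
    9, so the leading term of D is that of a X^2.  The roots then come from
    the intermediate value theorem between 1/6 and 1, and between 1 and a large
    number. *)

Set Implicit Arguments.
Unset Strict Implicit.
Unset Printing Implicit Defensive.

Import Order.TTheory GRing.Theory Num.Theory.
Import numFieldNormedType.Exports.

Local Open Scope classical_set_scope.
Local Open Scope ring_scope.

(** * Resultants of low degree *)

Section Res.
Variable A : comNzRingType.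

(** Matrices given by literal lists of rows, so that Laplace expansion of a
    small determinant is plain computation. *)
Definition mx_of_rows n (M : seq (seq A)) : 'M[A]_n :=
  \matrix_(i < n, j < n) (nth [::] M i)`_j.

Definition drop_at (j : nat) (r : seq A) := take j r ++ drop j.+1 r.

Lemma nth_drop_at j r k : (drop_at j r)`_k = r`_(bump j k).
Proof.
elim: j r k => [|j IHj] [|x r] [|k] //=; rewrite ?nth_nil //.
- by rewrite /drop_at /= drop0.
- by rewrite /drop_at /= drop0.
- by rewrite -/(drop_at j r) IHj /bump ltnS addnS.
Qed.

Lemma det_mx_of_rows n r M :
  \det (mx_of_rows n.+1 (r :: M)) =
  \sum_(j < n.+1) r`_j * ((-1) ^+ j * \det (mx_of_rows n (map (drop_at j) M))).
Proof.
rewrite (expand_det_row _ ord0); apply: eq_bigr => j _.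
rewrite mxE /cofactor add0n; congr (_ * (_ * \det _)).
apply/matrixP => i k; rewrite !mxE /= -nth_drop_at.
have [iM|Mi] := ltnP i (size M); first by rewrite (nth_map [::]).
by rewrite ![nth _ _ i]nth_default ?size_map //= !nth_nil.
Qed.

Definition sylvester_rows (s t : seq A) : seq (seq A) :=
  mkseq (fun i => nseq i 0 ++ s) (size t).-1
  ++ mkseq (fun i => nseq i 0 ++ t) (size s).-1.

Lemma resultant_Poly s t : last 1 s != 0 -> last 1 t != 0 ->
  resultant (Poly s) (Poly t) =
  \det (mx_of_rows ((size t).-1 + (size s).-1) (sylvester_rows s t)).
Proof.
move=> /PolyK Ps /PolyK Pt; rewrite -[s in RHS]Ps -[t in RHS]Pt /resultant.
have band (r : seq A) i j : r`_(j - i) *+ (i <= j) = (nseq i 0 ++ r)`_j.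
  by rewrite nth_cat size_nseq nth_nseq mulrb; case: ltnP.
congr (\det _); apply/matrixP => i j; rewrite Sylvester_mxE !mxE.
rewrite nth_cat size_mkseq; case: split_ordP => k -> /=.
  by rewrite nth_mkseq // -band.
by rewrite addKn nth_mkseq // -band.
Qed.

(** One round of Laplace expansion along the first row.  Zero entries are
    pruned at once, which keeps the expansion of a Sylvester matrix small. *)
Ltac expand_det :=
  rewrite !det_mx_of_rows !(big_ord_recl, big_ord0) /=
    !(mul0r, mulr0, addr0, add0r) /drop_at /=.

Lemma resultant_quadratic_quadratic (p0 p1 p2 q0 q1 q2 : A) :
    p2 != 0 -> q2 != 0 ->
  resultant (Poly [:: p0; p1; p2]) (Poly [:: q0; q1; q2]) =
  (p2 * q0 - p0 * q2) ^+ 2 - (p2 * q1 - p1 * q2) * (p1 * q0 - p0 * q1).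
Proof.
move=> p2_neq0 q2_neq0; rewrite resultant_Poly // /sylvester_rows /mkseq /=.
do 4! expand_det; rewrite det_mx00 /bump /=; ring.
Qed.

(** If x1, x2 are the roots of p, the resultant is p2^4 q(x1) q(x2), a
    symmetric function of the roots; S_m below is p2^m (x1^m + x2^m). *)
Lemma resultant_quadratic_quartic (p0 p1 p2 q0 q1 q2 q3 q4 : A) :
    p2 != 0 -> q4 != 0 ->
  resultant (Poly [:: p0; p1; p2]) (Poly [:: q0; q1; q2; q3; q4]) =
  let S1 := - p1 in
  let S2 := p1 ^+ 2 - 2 * p0 * p2 in
  let S3 := - p1 ^+ 3 + 3 * p0 * p1 * p2 in
  let S4 := p1 ^+ 4 - 4 * p0 * p1 ^+ 2 * p2 + 2 * p0 ^+ 2 * p2 ^+ 2 in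
  q0 ^+ 2 * p2 ^+ 4 + q1 ^+ 2 * p0 * p2 ^+ 3 + q2 ^+ 2 * p0 ^+ 2 * p2 ^+ 2
  + q3 ^+ 2 * p0 ^+ 3 * p2 + q4 ^+ 2 * p0 ^+ 4
  + (q0 * q1 * p2 ^+ 3 + q1 * q2 * p0 * p2 ^+ 2
     + q2 * q3 * p0 ^+ 2 * p2 + q3 * q4 * p0 ^+ 3) * S1
  + (q0 * q2 * p2 ^+ 2 + q1 * q3 * p0 * p2 + q2 * q4 * p0 ^+ 2) * S2
  + (q0 * q3 * p2 + q1 * q4 * p0) * S3 + q0 * q4 * S4.
Proof.
move=> p2_neq0 q4_neq0; rewrite resultant_Poly // /sylvester_rows /mkseq /=.
do 6! expand_det.
rewrite det_mx00 /bump /=; ring.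
Qed.

(** Only q modulo p matters.  When that remainder is r(x^2), the resultant is
    that of r(y) with p2^2 y^2 + b y + p0^2, the quadratic whose roots are the
    squares of the roots of p. *)
Lemma resultant_even_remainder (p0 p1 p2 w0 w1 w2 r0 r1 r2 : A) :
    p2 != 0 -> p2 * w2 + r2 != 0 ->
  let b := 2 * p0 * p2 - p1 ^+ 2 in
  resultant (Poly [:: p0; p1; p2])
    (Poly [:: p0; p1; p2] * Poly [:: w0; w1; w2] + Poly [:: r0; 0; r1; 0; r2]) =
  (p2 ^+ 2 * r0 - p0 ^+ 2 * r2) ^+ 2
  - (p2 ^+ 2 * r1 - b * r2) * (b * r0 - p0 ^+ 2 * r1).
Proof.
move=> p2_neq0 q4_neq0 b.
have -> : Poly [:: p0; p1; p2] * Poly [:: w0; w1; w2]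
    + Poly [:: r0; 0; r1; 0; r2] =
  Poly [:: p0 * w0 + r0; p0 * w1 + p1 * w0; p0 * w2 + p1 * w1 + p2 * w0 + r1;
           p1 * w2 + p2 * w1; p2 * w2 + r2].
  by rewrite /= !cons_poly_def; ring.
rewrite resultant_quadratic_quartic //= /b.
ring.
Qed.
End Res.

(** * Elimination of z and x *)

Section Det.
Variable A : comNzRingType.
Implicit Types a u s : A.

(** The polynomial D.  The leading coefficient of E2 is 2 a (6 u - 1) and its
    constant one u^2 C; K and H are the coefficients of the reduced form
    4 a H x^2 - 2 s u^2 K of G.  The relation
      (6 u - 1) s K + C H = 3 (u - 1) Q
    is the source of the factor (u - 1)^2.  With p = E2 and r the even
    remainder, the three factors in [resultant_even_remainder] are
      p2^2 r0 - p0^2 r2 = 48 a u^4 (u - 1) X,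
      b r0 - p0^2 r1 = 48 s u^6 (u - 1) Y,
      p2^2 r1 - b r2 = - 192 a u^2 (u - 1) Z. *)
Definition dtrC s u := 3 * s * u + 3 * u + 1.
Definition dtrK s u := 3 * s * u + 6 * u - 2.
Definition dtrH s u := 3 * (3 * u - 1) * (u - 1) - s * (6 * u - 1).
Definition dtrQ s u := s * (6 * u - 1) + (3 * u - 1) * dtrC s u.
Definition dtrX a s u :=
  a * dtrQ s u * ((6 * u - 1) * s * dtrK s u - dtrC s u * dtrH s u)
  - 18 * s * u ^+ 2 * (3 * u - 1) * dtrC s u ^+ 2.
Definition dtrY a s u :=
  a * dtrC s u * dtrK s u * dtrQ s u
  + 18 * s * u ^+ 2 * (dtrC s u ^+ 2 - 4 * dtrC s u - 6 * (u - 1)).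
Definition dtrZ a s u :=
  a ^+ 2 * (6 * u - 1) * dtrH s u * dtrQ s u
  + 18 * a * u ^+ 2 * (s ^+ 2 * (6 * u - 1) ^+ 2
      + 4 * s * (6 * u - 1) * (3 * u - 1) - 6 * (3 * u - 1) ^+ 2 * (u - 1)
      + s * (6 * u - 1) * (3 * u - 1) * dtrC s u)
  - 648 * s * u ^+ 4 * (3 * u - 1).
Definition detector a s u :=
  a * dtrX a s u ^+ 2 + 4 * s * dtrY a s u * dtrZ a s u.

End Det.

Section Elim.
Variables (R : realType) (a rho : R).
Hypothesis (a_neq0 : a != 0).

Local Notation s := (rho^-1)%:P.

(** The coefficient A of z^2 in E3, as a polynomial in x. *)
Definition E3_lead : {poly {poly R}} :=
  Poly [:: 'X ^+ 2 * (s + 3 * 'X + 1); - 12 * 'X ^+ 2;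
           a%:P * (9 * 'X ^+ 2 + 1)].

(** The polynomial R(x, u) left once z is eliminated. *)
Definition elim_z : {poly {poly R}} :=
  (2 * s%:P * 'X%:P ^+ 2 * (3 * 'X%:P + 1 - 12 * 'X) + 4 * E3_lead) ^+ 2
  + 288 * s%:P * 'X%:P ^+ 2 * 'X ^+ 2 * E3_lead.

Lemma E1E : E1 R = Poly [:: - 4 * 'X ^+ 2; 12 * 'X ^+ 2;
                            3 * 'X%:P + 1 - 12 * 'X].
Proof. by rewrite /E1 /einstein1 /= !cons_poly_def; ring. Qed.

Lemma E3E : E3 a rho =
  Poly [:: 2 * 'X%:P ^+ 2 * s%:P * 'X ^+ 2; 0; E3_lead].
Proof. by rewrite /E3 /einstein3 /E3_lead /= !cons_poly_def; ring. Qed.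

Lemma E2E : E2 a rho =
  Poly [:: 'X ^+ 2 * dtrC s 'X; - 12 * 'X ^+ 2; 2 * a%:P * (6 * 'X - 1)].
Proof. by rewrite /E2 /einstein2 /dtrC /= !cons_poly_def; ring. Qed.

(** Division of R by E2.  From A = E2 + A' and G = (2 s + 4) E2 + G', where A'
    and G' are the even reduced forms, the quotient is
    (2 s + 4) (2 G' + (2 s + 4) E2) + 288 s u^2 x^2 and the remainder is
    G'^2 + 288 s u^2 x^2 A'. *)
Lemma elim_zE :
  elim_z =
  E2 a rho * Poly
    [:: - 8 * s * (s + 2) * 'X ^+ 2 * dtrK s 'X
          + 4 * (s + 2) ^+ 2 * 'X ^+ 2 * dtrC s 'X;
        - 48 * (s + 2) ^+ 2 * 'X ^+ 2;
        16 * (s + 2) * a%:P * dtrH s 'X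
          + 8 * (s + 2) ^+ 2 * a%:P * (6 * 'X - 1) + 288 * s * 'X ^+ 2]
  + Poly
    [:: 4 * s ^+ 2 * 'X ^+ 4 * dtrK s 'X ^+ 2;
        0;
        - 16 * a%:P * s * 'X ^+ 2 * dtrH s 'X * dtrK s 'X
          - 288 * s ^+ 2 * 'X ^+ 4 * (3 * 'X - 1);
        0;
        16 * a%:P ^+ 2 * dtrH s 'X ^+ 2
          + 864 * a%:P * s * 'X ^+ 2 * (3 * 'X - 1) * ('X - 1)].
Proof.
by rewrite /elim_z E2E /E3_lead /dtrC /dtrH /dtrK /= !cons_poly_def; ring.
Qed.

Lemma resultant_E1_E3 : resultant (E1 R) (E3 a rho) = 'X^4 * elim_z.
Proof.
rewrite E1E E3E resultant_quadratic_quadratic /elim_z /=.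
- ring.
(* The leading coefficients in z: 3 u + 1 - 12 x is 1 at x = u = 0, and A is a
   at x = 1, u = 0. *)
- apply/eqP => /(congr1 (fun p => p.[0].[0])).
  by rewrite !hornerE /= subr0 => /eqP; rewrite oner_eq0.
- apply: contra_neq a_neq0 => /(congr1 (fun p => p.[1].[0])).
  by rewrite /E3_lead /= !cons_poly_def !hornerE /=; lra.
Qed.

Lemma resultant_E2_elim_z : exists2 k : R, k != 0 &
  resultant (E2 a rho) elim_z =
  k *: ('X^8 * ('X - 1) ^+ 2 * detector a%:P s 'X).
Proof.
exists (48 ^+ 2 * a); first by rewrite mulf_neq0 ?expf_neq0 ?pnatr_eq0.
rewrite elim_zE E2E resultant_even_remainder.
- rewrite -mul_polyC /detector /dtrX /dtrY /dtrZ /dtrQ /dtrH /dtrK /dtrC.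
  ring.
- apply: contra_neq a_neq0 => /(congr1 (fun p => p.[0])).
  by rewrite !hornerE /=; lra.
(* The coefficient of x^4 in R, in factored form. *)
- set lc := (X in X != 0).
  have -> : lc = 16 * (a%:P * (9 * 'X ^+ 2 + 1))
                 * (a%:P * (9 * 'X ^+ 2 + 1) + 18 * s * 'X ^+ 2).
    by rewrite /lc /dtrH /dtrC; ring.
  rewrite -mulrA; apply/mulf_neq0; last apply/mulf_neq0;
  apply: contra_neq a_neq0 => /(congr1 (fun p => p.[0])).
  + by rewrite !hornerE /=; lra.
  + by rewrite !hornerE /=; lra.
  + by rewrite !hornerE /=; lra.
Qed.

(** Cancelling x^4 and u^8 (u - 1)^2 determines a detector up to scaling. *)
Lemma is_detectorP (D : {poly R}) :
  is_detector a rho D <-> exists2 c : R, c != 0 & D = c *: detector a%:P s 'X.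
Proof.
have [k k_neq0 res_elim_z] := resultant_E2_elim_z.
split=> [[Q [C [resQ C_neq0 resD]]] | [c c_neq0 ->]]; last first.
  exists elim_z, (k / c); split; first exact: resultant_E1_E3.
    by rewrite mulf_neq0 ?invr_eq0.
  by rewrite res_elim_z -scalerAr scalerA mulfVK.
have QE : Q = elim_z.
  by apply: (mulfI (monic_neq0 (monicXn _ 4))); rewrite -resQ resultant_E1_E3.
exists (k / C); first by rewrite mulf_neq0 ?invr_eq0.
have nz : 'X^8 * ('X - 1) ^+ 2 != 0 :> {poly R}.
  by rewrite mulf_neq0 ?expf_neq0 ?polyX_eq0 // polyXsubC_eq0.
apply: (mulfI nz); apply: (scalerI C_neq0).
by rewrite -resD QE res_elim_z -scalerAr scalerA (mulrC C) mulfVK.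
Qed.
End Elim.

(** * Signs of the detector *)

Section Signs.
Variables (R : realType).
Implicit Types a s u : R.

Lemma detector_at0 a :
  detector a (2 * (1 - a)) 0 = 9 * a ^+ 3 * (3 - 2 * a) ^+ 4.
Proof.
by rewrite /detector /dtrX /dtrY /dtrZ /dtrQ /dtrH /dtrK /dtrC; ring.
Qed.

(** At this point 6 u - 1 = 0 and C = c, hence X = c^2 (5 a + 2 s) / 8 and
    Z = (5 a + 2 s) / 8; the relation s - 2 = - 2 a makes both terms of Y
    nonnegative. *)
Lemma detector_at_sixth a (s := 2 * (1 - a)) (c := (s + 3) / 2) :
  detector a s (1 / 6) = (5 * a + 2 * s) / 64 *
    (a * c ^+ 4 * (5 * a + 2 * s)
     + 32 * s * (a ^+ 2 * c ^+ 2 / 2 + s / 2 * ((c - 2) ^+ 2 + 1))).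
Proof.
rewrite /detector /dtrX /dtrY /dtrZ /dtrQ /dtrH /dtrK /dtrC /c /s; by field.
Qed.

Lemma detector_at1 a : a < 1 ->
  detector a (2 * (1 - a)) 1 =
  192 ^+ 2 * (1 - a) ^+ 4 * (5 - 3 * a) * Xi (2 * (1 - a))^-1 (a * (1 - a)).
Proof.
move=> a_lt1; rewrite /detector /dtrX /dtrY /dtrZ /dtrQ /dtrH /dtrK /dtrC /Xi.
by field; lra.
Qed.

Lemma detector_at0_gt0 a : 0 < a < 1 -> 0 < detector a (2 * (1 - a)) 0.
Proof.
move=> /andP[a_gt0 a_lt1]; rewrite detector_at0 !(mulr_gt0, exprn_gt0) //; lra.
Qed.

Lemma detector_at_sixth_gt0 a :
  0 < a < 1 -> 0 < detector a (2 * (1 - a)) (1 / 6).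
Proof.
move=> /andP[a_gt0 a_lt1]; rewrite detector_at_sixth.
have s_gt0 : 0 < 2 * (1 - a) by lra.
move: (2 * (1 - a)) s_gt0 => s s_gt0.
have c_gt0 : 0 < (s + 3) / 2 by lra.
have : 0 < ((s + 3) / 2 - 2) ^+ 2 + 1 by rewrite ltr_wpDl // sqr_ge0.
move: (_ ^+ 2 + 1) => t t_gt0.
by rewrite !(mulr_gt0, exprn_gt0, addr_gt0, invr_gt0).
Qed.

Lemma sgr_detector_at1 a : 0 < a < 1 ->
  Num.sg (detector a (2 * (1 - a)) 1) =
  Num.sg (Xi (2 * (1 - a))^-1 (a * (1 - a))).
Proof.
move=> /andP[a_gt0 a_lt1]; rewrite detector_at1 // sgrM gtr0_sg ?mul1r //.
by rewrite !(mulr_gt0, exprn_gt0) //; lra.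
Qed.

End Signs.

Lemma rmorph_detector (A B : comNzRingType) (f : {rmorphism A -> B}) a s u :
  f (detector a s u) = detector (f a) (f s) (f u).
Proof.
by rewrite /detector /dtrX /dtrY /dtrZ /dtrQ /dtrH /dtrK /dtrC; ring.
Qed.

Lemma horner_detector (R : realType) (a s u : R) :
  (detector a%:P s%:P 'X).[u] = detector a s u.
Proof. by rewrite -horner_evalE rmorph_detector /= !horner_evalE !hornerE. Qed.

Lemma poly_cvg_pinfty (R : realType) (p : {poly R}) :
    (1 < size p)%N -> 0 < lead_coef p ->
  p.[u] @[u --> +oo] --> +oo.
Proof.
move=> p_nconst lead_p; apply/cvgryPge => M.
have size_M : (size (- M%:P) < size p)%N.
  by rewrite size_polyN (leq_ltn_trans (size_polyC_leq1 M)).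
have lead_pM : 0 < lead_coef (p - M%:P) by rewrite lead_coefDl.
have [B gtB] := poly_pinfty_gt_lc lead_pM.
near=> u.
have : B <= u by near: u; apply: nbhs_pinfty_ge; rewrite num_real.
by move=> /gtB /(lt_le_trans lead_pM) /ltW; rewrite !hornerE subr_ge0.
Unshelve. all: by end_near. Qed.

(** The explicit coefficient lists below only serve to bound the degrees and
    to exhibit the top coefficient of X; they are expansions in u. *)
Section Lead.
Variables (R : realType) (a s : R).
Hypotheses (a_gt0 : 0 < a) (s_gt0 : 0 < s).

Lemma dtrX_lead : size (dtrX a%:P s%:P 'X) = 6 /\
  lead_coef (dtrX a%:P s%:P 'X) = - (3 ^+ 5 * (s + 1) ^+ 2 * (a + 2 * s)).
Proof.
set x5 := - (3 ^+ 5 * (s + 1) ^+ 2 * (a + 2 * s)).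
have x5_neq0 : x5 != 0.
  by rewrite oppr_eq0 lt0r_neq0 // !(mulr_gt0, exprn_gt0, addr_gt0).
have -> : dtrX a%:P s%:P 'X = Poly
  [:: a * (3 + 2 * s - s ^+ 2);
      a * (- 3 + 12 * s + 33 * s ^+ 2 + 6 * s ^+ 3);
      18 * s - 9 * a * (6 + 14 * s + 21 * s ^+ 2 + 6 * s ^+ 3);
      54 * s + 108 * s ^+ 2 + 27 * a * (2 - 2 * s + s ^+ 2 + 2 * s ^+ 3);
      162 * s * (s ^+ 2 - 1)
        + 81 * a * (3 + 12 * s + 13 * s ^+ 2 + 4 * s ^+ 3);
      x5].
  by rewrite /x5 /dtrX /dtrQ /dtrH /dtrK /dtrC /= !cons_poly_def; ring.
by rewrite lead_coefE (PolyK (c := 0)).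
Qed.

Lemma size_dtrY : (size (dtrY a%:P s%:P 'X) <= 5)%N.
Proof.
have -> : dtrY a%:P s%:P 'X = Poly
  [:: 2 * a * (1 + s); 3 * a * s * (s - 1);
      54 * s - 9 * a * (4 + 7 * s + 5 * s ^+ 2 + s ^+ 3);
      - 108 * s * (2 + s) + 27 * a * s * (1 + s) ^+ 2;
      81 * (s + 1) ^+ 2 * (2 * s + a * (s + 2))].
  by rewrite /dtrY /dtrQ /dtrK /dtrC /= !cons_poly_def; ring.
exact: size_Poly.
Qed.

Lemma size_dtrZ : (size (dtrZ a%:P s%:P 'X) <= 6)%N.
Proof.
have -> : dtrZ a%:P s%:P 'X = Poly
  [:: a ^+ 2 * (1 + s) * (3 + s);
      - 3 * a ^+ 2 * (10 + 17 * s + 5 * s ^+ 2);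
      18 * a * (2 + s) * (3 + s)
        + 9 * a ^+ 2 * (6 + 19 * s + 7 * s ^+ 2);
      - 54 * a * (14 + 14 * s + 3 * s ^+ 2) + 27 * a ^+ 2 * (8 + 3 * s);
      648 * s + 162 * a * (10 + 7 * s + s ^+ 2)
        - 81 * a ^+ 2 * (9 + 11 * s + 4 * s ^+ 2);
      - 1944 * s + 972 * a * (s ^+ 2 + s - 1) + 486 * a ^+ 2 * (1 + s)].
  by rewrite /dtrZ /dtrQ /dtrH /dtrC /= !cons_poly_def; ring.
exact: size_Poly.
Qed.

Lemma lead_detector (D := detector a%:P s%:P 'X) :
  size D = 11 /\ 0 < lead_coef D.
Proof.
have [sizeX leadX] := dtrX_lead.
have X_neq0 : dtrX a%:P s%:P 'X != 0 by rewrite -size_poly_gt0 sizeX.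
have aX2E : a%:P * dtrX a%:P s%:P 'X ^+ 2 = a *: (dtrX a%:P s%:P 'X ^+ 2).
  by rewrite mul_polyC.
have size_aX2 : size (a%:P * dtrX a%:P s%:P 'X ^+ 2) = 11.
  by rewrite aX2E size_scale ?gt_eqF // expr2 size_mul // sizeX.
pose sYZ : {poly R} := 4 * s%:P * dtrY a%:P s%:P 'X * dtrZ a%:P s%:P 'X.
have size_sYZ : (size sYZ < 11)%N.
  have -> : sYZ = (4 * s) *: (dtrY a%:P s%:P 'X * dtrZ a%:P s%:P 'X).
    by rewrite -mul_polyC /sYZ; ring.
  apply: leq_ltn_trans (size_scale_leq _ _) _.
  apply: leq_ltn_trans (size_polyMleq _ _) _.
  have := leq_add size_dtrY size_dtrZ; set m := (_ + _)%N; lia.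
rewrite /D /detector size_polyDl ?lead_coefDl ?size_aX2 //; split=> //.
rewrite aX2E lead_coefZ lead_coef_exp leadX.
rewrite mulr_gt0 // exprn_even_gt0 //= oppr_eq0 lt0r_neq0 //.
by rewrite !(mulr_gt0, exprn_gt0, addr_gt0).
Qed.
End Lead.

(** * Traces and frames *)

Section Trace.
Variables (R : realType) (h : vectType R).
Implicit Types (U : {vspace h}) (f g : 'End(h)).

Lemma trace_onD U f g : trace_on U (f + g) = trace_on U f + trace_on U g.
Proof.
rewrite /trace_on -big_split; apply: eq_bigr => i _.
by rewrite lfunE /= linearD.
Qed.

Lemma trace_onZ U c f : trace_on U (c *: f) = c * trace_on U f.
Proof.
by rewrite /trace_on mulr_sumr; apply: eq_bigr => i _; rewrite lfunE /= linearZ.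
Qed.

Lemma trace_onN U f : trace_on U (- f) = - trace_on U f.
Proof. by rewrite -scaleN1r trace_onZ mulN1r. Qed.

(** Both sides are the sum of f_ij g_ji over the matrix entries. *)
Lemma trace_on_comp f g :
  trace_on fullv (f \o g)%VF = trace_on fullv (g \o f)%VF.
Proof.
pose b := vbasis {: h}.
have coord_comp (p q : 'End(h)) i : coord b i ((p \o q)%VF b`_i) =
    \sum_j coord b j (q b`_i) * coord b i (p b`_j).
  rewrite lfunE /= [in LHS](coord_vbasis (memvf (q b`_i))) !linear_sum /=.
  by apply: eq_bigr => j _; rewrite !linearZ.
rewrite /trace_on; under eq_bigr => i _ do rewrite coord_comp.
rewrite exchange_big /=; apply: eq_bigr => i _; rewrite coord_comp.
by apply: eq_bigr => j _; rewrite mulrC.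
Qed.

End Trace.

Section Frame.
Variables (R : realType) (h : vectType R) (Q : h -> {linear h -> R^o}).
Implicit Types (U : {vspace h}) (f : {linear h -> h}).
Hypothesis Q_sym : forall x y, Q x y = Q y x.
Hypothesis Q_pos : forall x, x != 0 -> 0 < Q x x.

(** Any list satisfying Parseval's expansion on U, for instance a
    Q-orthonormal basis.  Neither freeness nor orthonormality has to be
    carried around: the expansion alone computes traces, dimensions and
    norms. *)
Definition frame U (X : seq h) : Prop :=
  {subset X <= U} /\ {in U, forall v, v = \sum_(x <- X) Q x v *: x}.

(** Gram-Schmidt: normalise a vector of U, and recurse in its orthogonal
    complement inside U. *)
Lemma frame_exists U : exists X, frame U X.
Proof.
have [n] := ubnP (\dim U); elim: n U => // n IHn U; rewrite ltnS => dimU.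
have [->|U_neq0] := eqVneq U 0%VS.
  by exists [::]; split=> // v; rewrite memv0 big_nil => /eqP.
have w_neq0 : vpick U != 0 by rewrite vpick0.
set w := vpick U in w_neq0.
pose n2 := Q w w; have n2_gt0 : 0 < n2 by exact: Q_pos.
pose e := (Num.sqrt n2)^-1 *: w.
have eU : e \in U by rewrite memvZ // memv_pick.
have Qee : Q e e = 1.
  rewrite linearZ /= Q_sym linearZ /= -/n2.
  rewrite /GRing.scale /= mulrA -invfM -expr2 sqr_sqrtr ?ltW // mulVf //.
  by rewrite gt_eqF.
pose W := (U :&: lker (linfun (Q e)))%VS.
have memW v : (v \in W) = (v \in U) && (Q e v == 0).
  by rewrite memv_cap memv_ker lfunE.
have /IHn[X [XW frameX]] : (\dim W < n)%N.
  apply: leq_trans dimU; rewrite ltn_neqAle dimvS ?capvSl // andbT.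
  apply: contraTneq eU => dimWU; have /eqP <- : W == U.
    by rewrite -(dimv_leqif_eq (capvSl _ _)) dimWU.
  by rewrite memW Qee oner_eq0 andbF.
exists (e :: X); split=> [x|v vU].
  by rewrite inE => /predU1P[-> //|/XW]; rewrite memW => /andP[].
have vW : v - Q e v *: e \in W.
  rewrite memW memvB ?(memvZ _ eU) //= linearB linearZ /= Qee.
  by rewrite /GRing.scale /= mulr1 subrr.
rewrite big_cons; apply/eqP; rewrite addrC -subr_eq; apply/eqP.
rewrite [LHS](frameX _ vW); apply: eq_big_seq => x /XW.
rewrite memW => /andP[_ /eqP Qex].
by rewrite linearB linearZ /= (Q_sym x e) Qex scaler0 subr0.
Qed.

Lemma trace_on_frame U X f : frame U X -> {in U, forall v, f v \in U} ->
  trace_on U f = \sum_(x <- X) Q x (f x).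
Proof.
move=> [XU frameX] fU; pose b := vbasis U.
have bU (i : 'I_(\dim U)) : b`_i \in U.
  by rewrite vbasis_mem // mem_nth // size_tuple.
have -> : trace_on U f =
    \sum_(i < \dim U) \sum_(x <- X) Q x (f b`_i) * coord b i x.
  apply: eq_bigr => i _; rewrite [in LHS](frameX _ (fU _ (bU i))) linear_sum.
  by apply: eq_bigr => x _; rewrite linearZ.
rewrite exchange_big /=; apply: eq_big_seq => x /XU xU.
rewrite [X in f X](coord_vbasis xU) !linear_sum /=.
by apply: eq_bigr => i _; rewrite !linearZ /= mulrC.
Qed.

(** The trace of the identity. *)
Lemma dim_frame U X : frame U X -> \sum_(x <- X) Q x x = (\dim U)%:R.
Proof.
move=> frameX; rewrite -(@trace_on_frame U X idfun) //.
rewrite /trace_on -[RHS]mulr1 mulr_natl.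
rewrite -[in RHS](card_ord (\dim U)) -sumr_const.
apply: eq_bigr => i _ /=.
by rewrite coord_free ?eqxx // (basis_free (vbasisP U)).
Qed.

Lemma frame_norm U X v : frame U X -> v \in U ->
  Q v v = \sum_(x <- X) Q x v ^+ 2.
Proof.
move=> [_ frameX] /frameX vE; rewrite [in LHS]vE linear_sum.
by apply: eq_bigr => x _; rewrite linearZ /= -vE Q_sym.
Qed.
End Frame.

(** * The Killing form of a symmetric pair *)

Section Killing.
Variables (R : realType) (h : vectType R) (br : h -> h -> h).
Hypothesis lie : lie_bracket br.
Implicit Types (U : {vspace h}) (x y z : h).

Definition ad_linear x : {linear h -> h} :=
  HB.pack (br x) (GRing.isLinear.Build R h h *:%R (br x) (lie_linearr lie x)).

Definition ad x : 'End(h) := linfun (ad_linear x).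

Lemma adE x y : ad x y = br x y. Proof. by rewrite lfunE. Qed.

Lemma killingE U x y : killing br U x y = trace_on U (ad x \o ad y)%VF.
Proof. by apply: eq_bigr => i _; rewrite lfunE /= !adE. Qed.

Lemma adP c x y : ad (c *: x + y) = c *: ad x + ad y.
Proof.
apply/lfunP => z; rewrite add_lfunE scale_lfunE !adE.
exact: (lie_linearl lie z).
Qed.

Lemma br_antisym x y : br x y = - br y x.
Proof.
apply/eqP; rewrite -addr_eq0 -!adE; apply/eqP.
have := lie_alternating lie (1 *: x + y); rewrite -adE adP scale1r.
rewrite !add_lfunE !linearD /= !linearZ /= !adE !(lie_alternating lie).
by rewrite !scale1r add0r addr0.
Qed.

Lemma br_oppr x y : br x (- y) = - br x y.
Proof. by rewrite -(adE x (- y)) linearN /= adE. Qed.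

Lemma ad_br x y : ad (br x y) = ((ad x \o ad y) - (ad y \o ad x))%VF.
Proof.
apply/lfunP => z; rewrite add_lfunE opp_lfunE !comp_lfunE !adE.
rewrite br_antisym; have /eqP := lie_jacobi lie x y z.
rewrite addr_eq0 => /eqP <-; congr (_ + _).
by rewrite (br_antisym z x) br_oppr.
Qed.

Lemma killing_sym x y : killing br fullv x y = killing br fullv y x.
Proof. by rewrite !killingE trace_on_comp. Qed.

Lemma killing_linear x : linear (killing br fullv x : h -> R^o).
Proof.
move=> c y z; rewrite !killingE adP comp_lfunDr -comp_lfunZr.
by rewrite trace_onD trace_onZ.
Qed.

Lemma killing_opp_linear x :
  linear ((fun y => - killing br fullv x y) : h -> R^o).
Proof. by move=> c y z; rewrite killing_linear opprD scalerN. Qed.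

(** The positive definite form - B_h.  It is kept opaque, so that
    simplification does not unfold it to the Killing form. *)
Lemma opp_killing_form : {Q : h -> {linear h -> R^o} |
  forall x y, Q x y = - killing br fullv x y}.
Proof.
pose Q x : {linear h -> R^o} := HB.pack (fun y => - killing br fullv x y : R^o)
  (GRing.isLinear.Build R h R^o *:%R _ (killing_opp_linear x)).
by exists Q.
Qed.

Definition form : h -> {linear h -> R^o} := sval opp_killing_form.

Lemma formE x y : form x y = - killing br fullv x y.
Proof. exact: (svalP opp_killing_form). Qed.

Lemma killing_invariant x y z :
  killing br fullv (br x y) z = killing br fullv x (br y z).
Proof.
rewrite !killingE !ad_br comp_lfunDl comp_lfunDr comp_lfunNl comp_lfunNr.
rewrite !trace_onD !trace_onN -!comp_lfunA.
by congr (_ - _); rewrite [LHS]trace_on_comp comp_lfunA.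
Qed.

Section Involution.
Variable theta : 'End(h).
Hypothesis theta_invol : forall x, theta (theta x) = x.
Hypothesis theta_br : forall x y, theta (br x y) = br (theta x) (theta y).

(** ad (theta x) is the conjugate of ad x by theta. *)
Lemma killing_theta x y :
  killing br fullv (theta x) (theta y) = killing br fullv x y.
Proof.
have ad_theta z : ad (theta z) = (theta \o ad z \o theta)%VF.
  by apply/lfunP => v; rewrite !comp_lfunE !adE theta_br theta_invol.
have theta2 : (theta \o theta)%VF = \1%VF.
  by apply/lfunP => v; rewrite comp_lfunE id_lfunE theta_invol.
rewrite !killingE !ad_theta -!comp_lfunA trace_on_comp -!comp_lfunA theta2.
by rewrite comp_lfun1r (comp_lfunA theta theta) theta2 comp_lfun1l.
Qed.

Lemma mem_sym_k x : (x \in sym_k theta) = (theta x == x).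
Proof. exact: (sameP fixedSpaceP eqP). Qed.

Lemma mem_sym_q x : (x \in sym_q theta) = (theta x == - x).
Proof.
rewrite memv_ker add_lfunE opp_lfunE scale_lfunE id_lfunE scaleN1r opprK.
by rewrite addr_eq0.
Qed.

Lemma form_kq : {in sym_k theta & sym_q theta, forall x y, form x y = 0}.
Proof.
move=> x y; rewrite mem_sym_k mem_sym_q => /eqP xk /eqP yq.
have : form (theta x) (theta y) = form x y by rewrite !formE killing_theta.
by rewrite xk yq linearN /= => formN; apply/eqP; rewrite -eqNr formN.
Qed.

End Involution.
End Killing.

Section Symmetric.
Variables (R : realType) (h : vectType R) (br : h -> h -> h) (theta : 'End(h)).
Hypothesis sym : irreducible_compact_symmetric br theta.
Let lie := sym_lie sym.
Let k := sym_k theta.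
Let q := sym_q theta.
Local Notation form := (form lie).

Lemma form_sym x y : form x y = form y x.
Proof. by rewrite !formE (killing_sym lie). Qed.

Lemma form_pos x : x != 0 -> 0 < form x x.
Proof. by rewrite formE oppr_gt0; apply: sym_compact sym _. Qed.

Lemma form_ge0 x : 0 <= form x x.
Proof.
have [->|/form_pos/ltW//] := eqVneq x 0.
by rewrite linear0.
Qed.

Lemma form_invariant x y z : form (br x y) z = form x (br y z).
Proof. by rewrite !formE (killing_invariant lie). Qed.

Lemma form_ad_skew x y z : form x (br y z) = - form (br y x) z.
Proof.
rewrite -form_invariant (br_antisym lie) form_sym linearN.
by rewrite [X in _ = - X]form_sym.
Qed.

(** The trace of (ad x)^2, with one of the two factors moved across the form by
    skew-symmetry. *)
Lemma killing_frame U X x : frame form U X ->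
    {in U, forall v, br x v \in U} ->
  killing br U x x = - \sum_(z <- X) form (br x z) (br x z).
Proof.
move=> frameX xU; have ad2E v : (ad lie x \o ad lie x)%VF v = br x (br x v).
  by rewrite comp_lfunE !(adE lie).
rewrite (killingE lie) (trace_on_frame frameX) => [|v vU]; last first.
  by rewrite [X in X \in _]ad2E !xU.
rewrite -sumrN; apply: eq_bigr => z _.
by rewrite -form_ad_skew -ad2E.
Qed.

Lemma br_kk : {in k &, forall x y, br x y \in k}.
Proof.
move=> x y; rewrite !mem_sym_k => /eqP xk /eqP yk.
by rewrite (sym_automorphism sym) xk yk.
Qed.

Lemma br_qq : {in q &, forall x y, br x y \in k}.
Proof.
move=> x y.
rewrite (mem_sym_q _ x) (mem_sym_q _ y) mem_sym_k => /eqP xq /eqP yq.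
rewrite (sym_automorphism sym) xq yq (br_oppr lie) -(br_antisym lie).
by rewrite (br_oppr lie) -(br_antisym lie).
Qed.

Lemma br_kq : {in k & q, forall x y, br x y \in q}.
Proof.
move=> x y; rewrite mem_sym_k (mem_sym_q _ y) mem_sym_q => /eqP xk /eqP yq.
by rewrite (sym_automorphism sym) xk yq (br_oppr lie).
Qed.

Lemma frame_cat X Y : frame form k X -> frame form q Y ->
  frame form fullv (X ++ Y).
Proof.
move=> [Xk frameX] [Yq frameY]; split=> [x _|v _]; first exact: memvf.
have thth := sym_involution sym.
have form_kq := form_kq lie thth (sym_automorphism sym).
have [vk [vq [-> vkk vqq]]] :
    exists vk vq, [/\ v = vk + vq, vk \in k & vq \in q].
  exists (2^-1 *: (v + theta v)), (2^-1 *: (v - theta v)); split.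
  - rewrite -scalerDr addrACA subrr addr0 -mulr2n -[v *+ 2]scaler_nat.
    by rewrite scalerA mulVf ?scale1r // pnatr_eq0.
  - by rewrite mem_sym_k linearZ linearD /= thth addrC.
  - by rewrite mem_sym_q linearZ linearB /= thth -scalerN opprB.
have XE : \sum_(x <- X) form x (vk + vq) *: x = vk.
  rewrite [RHS](frameX _ vkk); apply: eq_big_seq => x /Xk xk.
  by rewrite linearD (form_kq _ _ xk vqq) addr0.
have YE : \sum_(y <- Y) form y (vk + vq) *: y = vq.
  rewrite [RHS](frameY _ vqq); apply: eq_big_seq => y /Yq yq.
  by rewrite linearD [form y vk]form_sym (form_kq _ _ vkk yq) add0r.
by rewrite big_cat; exact: esym (congr2 +%R XE YE).
Qed.

Section Constant.
Variable a : R.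
Hypothesis a_embed : embedding_constant br theta a.
Variables X Y : seq h.
Hypotheses (frameX : frame form k X) (frameY : frame form q Y).

(** The Killing form of k is the trace over the frame X of k alone; the trace
    over X ++ Y in [form_norm] gives that of h. *)
Lemma form_k_norm x : x \in k ->
  a * form x x = \sum_(z <- X) form (br x z) (br x z).
Proof.
move=> xk; rewrite formE mulrN -a_embed // (killing_frame frameX) ?opprK //.
by move=> v; apply: br_kk.
Qed.

Lemma form_norm x : form x x = \sum_(z <- X) form (br x z) (br x z) +
   \sum_(y <- Y) form (br x y) (br x y).
Proof.
rewrite [LHS]formE (killing_frame (frame_cat frameX frameY)) ?opprK ?big_cat //.
by move=> v _; apply: memvf.
Qed.

Lemma norm_brC x y : form (br x y) (br x y) = form (br y x) (br y x).
Proof.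
have formN v w : form v (- w) = - form v w by rewrite linearN.
by rewrite (br_antisym lie x y) formN form_sym formN opprK.
Qed.

(** The difference of [form_norm] and [form_k_norm], summed over X: this is
    minus the trace on q of the Casimir element of k. *)
Lemma casimir_kq : (1 - a) * (\dim k)%:R =
  \sum_(x <- X) \sum_(y <- Y) form (br x y) (br x y).
Proof.
rewrite -(dim_frame frameX) mulr_sumr; apply: eq_big_seq => x xX.
have xk : x \in k by apply: (proj1 frameX).
by rewrite mulrBl mul1r form_k_norm // [X in X - _]form_norm addrC addKr.
Qed.

(** For y in q, the brackets of y with k and with q contribute equally to the
    norm of y once summed over Y: both sums have the terms Q([x, y], z)^2, by
    invariance.  Hence the factor 2. *)
Lemma dim_q_casimir : (\dim q)%:R =
  2 * \sum_(x <- X) \sum_(y <- Y) form (br x y) (br x y).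
Proof.
rewrite -(dim_frame frameY).
transitivity (\sum_(y <- Y) (\sum_(x <- X) form (br x y) (br x y)
   + \sum_(z <- Y) form (br y z) (br y z))).
  apply: eq_bigr => y _; rewrite [LHS]form_norm; congr (_ + _).
  by apply: eq_bigr => x _; rewrite norm_brC.
rewrite big_split /= mulr_natl mulr2n exchange_big /=; congr (_ + _).
transitivity (\sum_(y <- Y) \sum_(z <- Y) \sum_(x <- X) form z (br x y) ^+ 2).
  apply: eq_big_seq => y yY; apply: eq_big_seq => z zY.
  rewrite (frame_norm form_sym frameX); last by rewrite br_qq ?(proj1 frameY).
  by apply: eq_bigr => x _; rewrite -form_invariant form_sym.
rewrite [RHS]exchange_big /=; apply: eq_big_seq => y yY.
rewrite exchange_big /=; apply: eq_big_seq => x xX.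
rewrite (frame_norm form_sym frameY) // br_kq //.
  exact: (proj1 frameX).
exact: (proj1 frameY).
Qed.

End Constant.

Variable a : R.
Hypothesis k_simple : lie_simple br k.
Hypothesis a_embed : embedding_constant br theta a.

Lemma dim_q_gt0 : (0 < \dim q)%N.
Proof. by rewrite lt0n dimv_eq0; apply: sym_nontrivial sym. Qed.

Lemma embedding_dim : 2 * (1 - a) * (\dim k)%:R = (\dim q)%:R.
Proof.
have [X frameX] := frame_exists form_sym form_pos k.
have [Y frameY] := frame_exists form_sym form_pos q.
rewrite (dim_q_casimir frameX frameY) -mulrA.
by rewrite (casimir_kq a_embed frameX frameY).
Qed.

Lemma embedding_lt1 : a < 1.
Proof.
rewrite ltNge; apply/negP => a_ge1; have := embedding_dim.
have : 0 < (\dim q)%:R :> R by rewrite ltr0n dim_q_gt0.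
have : 0 <= (\dim k)%:R :> R by [].
by nra.
Qed.

(** If a <= 0 then a Q(x, x), the sum of the |[x, z]|^2 over a frame of k, is
    nonpositive for every x in k; so k would be abelian. *)
Lemma embedding_gt0 : 0 < a.
Proof.
have [X frameX] := frame_exists form_sym form_pos k.
have [x [y [xk yk]]] := simple_nonabelian k_simple.
apply: contraNT; rewrite -leNgt => a_le0.
have brx0 : {in X, forall z, br x z = 0}.
  have : \sum_(z <- X) form (br x z) (br x z) <= 0.
    by rewrite -(form_k_norm a_embed frameX xk) mulr_le0_ge0 ?form_ge0.
  move=> sum_le0 z zX; apply/eqP; apply: contraTT sum_le0 => brxz.
  rewrite -ltNge (perm_big _ (perm_to_rem zX)) big_cons.
  by rewrite ltr_wpDr ?form_pos // sumr_ge0 // => w _; apply: form_ge0.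
rewrite (proj2 frameX _ yk) -(adE lie) linear_sum big_seq big1 // => z zX.
by rewrite linearZ /= (adE lie) brx0 // scaler0.
Qed.

End Symmetric.

(** * The theorem *)

Theorem theorem6p1 (R : realType) (h : vectType R) (br : h -> h -> h)
    (theta : 'End(h)) (a : R) :
  irreducible_compact_symmetric br theta ->
  lie_simple br fullv ->
  lie_simple br (sym_k theta) ->
  embedding_constant br theta a ->
  let d := \dim (sym_q theta) in
  let e := \dim (sym_k theta) in
  let rho : R := e%:R / d%:R in
  let sigma := a * (1 - a) in
  (exists D : {poly R}, is_detector a rho D) /\
  forall D : {poly R}, is_detector a rho D ->
    (exists2 c : R, c != 0 &
      let Dn := c *: D in
      [/\ 0 < Dn.[0],
          0 < Dn.[1 / 6],
          Dn.[u] @[u --> +oo] --> +oo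
        & Num.sg Dn.[1] = Num.sg (Xi rho sigma)]) /\
    (Xi rho sigma < 0 ->
      (exists2 u : R, 1 / 6 < u < 1 & root D u) /\
      (exists2 u : R, 1 < u & root D u)).
Proof.
move=> sym _ k_simple embed d e rho sigma.
have a_gt0 := embedding_gt0 sym k_simple embed.
have a_lt1 := embedding_lt1 sym embed.
have a01 : 0 < a < 1 by rewrite a_gt0.
pose s := 2 * (1 - a).
have s_gt0 : 0 < s by rewrite mulr_gt0 // subr_gt0.
have rhoE : rho = s^-1.
  rewrite /rho /d -(embedding_dim sym embed) -/s invfM mulrCA mulfV ?mulr1 //.
  have := dim_q_gt0 sym; rewrite -(ltr0n R) -(embedding_dim sym embed) -/s.
  by rewrite pmulr_rgt0 // => /lt0r_neq0.
have detP D : is_detector a rho D <->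
    exists2 c : R, c != 0 & D = c *: detector a%:P s%:P 'X.
  by rewrite (is_detectorP _ (lt0r_neq0 a_gt0)) rhoE invrK.
split=> [|D /detP[c c_neq0 ->]].
  exists (detector a%:P s%:P 'X); apply/detP.
  by exists 1; rewrite ?oner_eq0 ?scale1r.
set D0 := detector a%:P s%:P 'X.
have D0_0 : 0 < D0.[0] by rewrite horner_detector; apply: detector_at0_gt0.
have D0_6 : 0 < D0.[1 / 6].
  by rewrite horner_detector; apply: detector_at_sixth_gt0.
have D0_1 : Num.sg D0.[1] = Num.sg (Xi rho sigma).
  by rewrite horner_detector rhoE; apply: sgr_detector_at1.
have D0_oo : D0.[u] @[u --> +oo] --> +oo.
  have [size_D0 lead_D0] := lead_detector a_gt0 s_gt0.
  by apply: poly_cvg_pinfty => //; rewrite size_D0.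
split; first by exists c^-1; rewrite ?invr_eq0 // scalerA mulVf // scale1r.
move=> Xi_lt0; have D0_1_lt0 : D0.[1] < 0.
  by rewrite -sgr_lt0 D0_1 sgr_lt0.
have rootD (x y : R) : x < y -> D0.[x] * D0.[y] < 0 ->
    exists2 u : R, x < u < y & root (c *: D0) u.
  move=> xy /(poly_ivtoo (ltW xy))[u]; rewrite in_itv /= => xuy D0u.
  by exists u; rewrite // rootZ.
split; first by apply: rootD; [lra|rewrite pmulr_rlt0].
have [v [v_gt1 D0v]] : exists v : R, 1 < v /\ 0 < D0.[v].
  near (pinfty_nbhs R) => v; exists v; split.
    by near: v; apply: nbhs_pinfty_gt; rewrite num_real.
  by near: v; move/cvgryPgt : D0_oo; apply.
have [|u /andP[u_gt1 _] D0u] := rootD 1 v v_gt1; first by rewrite nmulr_rlt0.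
by exists u.
Unshelve. all: by end_near. Qed.
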